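(* Let $n$ be a power of an odd prime or the product of at most three (not necessarily distinct) odd primes. Then every subset of $\mathbb{Z}_n$ is uniquely determined up to translation by its $3$-deck: if $E,F\subseteq\mathbb{Z}_n$ have the same $3$-deck, then $F=E+t$ for some $t\in\mathbb{Z}_n$.
   Context: For $f:\mathbb{Z}_n\to\mathbb{R}$, the $3$-deck is $N_{f,3}(x_1,x_2)=\sum_{x\in\mathbb{Z}_n} f(x)f(x+x_1)f(x+x_2)$ for $x_1,x_2\in\mathbb{Z}_n$; the $3$-deck of $E\subseteq\mathbb{Z}_n$ is that of its indicator function $\chi_E$. *)

(* Defs.v *)
From HB Require Import structures.
From mathcomp Require Import all_boot all_order all_algebra.
From mathcomp Require Import reals.

Set Implicit Arguments.
Unset Strict Implicit.
Unset Printing Implicit Defensive.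

Import GRing.Theory.
Local Open Scope ring_scope.

(* The cyclic group Z_n is taken to be 'I_m.+1 with n = m.+1, whose canonical
   additive group structure is addition modulo m.+1; this is the trivial group
   for n = 1, unlike 'Z_1. *)

Definition deck3 (R : pzSemiRingType) (G : finZmodType) (f : G -> R)
    (x1 x2 : G) : R :=
  \sum_(x : G) f x * f (x + x1) * f (x + x2).

Definition indicator (R : pzSemiRingType) (G : finZmodType) (E : {set G})
    (x : G) : R :=
  (x \in E)%:R.

Definition translate (G : finZmodType) (E : {set G}) (t : G) : {set G} :=
  [set x + t | x in E].

(* Main.v *)
(* Let X and Y be the discrete Fourier transforms of the indicators of E and F.
   Equality of the 3-decks means X(k)X(l)X(-k-l) = Y(k)Y(l)Y(-k-l), so that X
   and Y have the same support S and the ratio Y/X is multiplicative on S, as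
   far as sums stay in S. By Galois conjugation S is a union of sets
   C_d = {k of order d}. Since n is odd, Galois conjugation and the doubling
   rule show that on each C_d the ratio is a character k |-> w^(k t_d), with t_d
   well defined mod d. It remains to glue: if t_d = t_e mod gcd(d, e) for all
   C_d, C_e in S, the generalized Chinese remainder theorem gives one t.
   If d divides e the congruence holds because an element of C_d is a difference
   of two elements of C_e. For the allowed n the only other case is d = g a,
   e = g b, n = g a b with g, a, b prime and a <> b. If C_n or C_g lies in S, or
   g differs from a and b and C_(ab) lies in S, then relations through this
   third class give the congruence. Otherwise, on each fibre of Z_n -> Z_g, the
   indicator of E is a sum of a function on Z_a and one on Z_b; being 0/1-valued
   it depends on one coordinate only, while all fibres meet E in the same number
   of points. Both coordinates do occur, so this number is divisible by a and by
   b, which is impossible on a fibre where E is not a trivial set. *)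
Require Import Defs.
From HB Require Import structures.
From mathcomp Require Import all_boot all_order all_algebra.
From mathcomp Require Import reals.
From mathcomp Require Import all_solvable all_field boolp zify ring.

Set Implicit Arguments.
Unset Strict Implicit.
Unset Printing Implicit Defensive.

(** * Arithmetic *)

Lemma coprime_by_primes (m n : nat) :
  (0 < n)%N -> (forall p, prime p -> p %| m -> p %| n -> False) ->
  coprime m n.
Proof.
move=> n_gt0 H; rewrite /coprime eqn_leq gcdn_gt0 n_gt0 orbT andbT leqNgt.
apply/negP => /pdivP[p p_pr]; rewrite dvdn_gcd => /andP[pm pn].
exact: H pm pn.
Qed.

(* Modulo a prime dividing [a] both numbers below are units since the part of
   [N] prime to [a] is; modulo any other prime they are [a] and [2a]. *)
Lemma coprime_pair_diff (N a : nat) :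
  odd N -> exists v, coprime v N /\ coprime (v + a) N.
Proof.
move=> oddN; have N_gt0 := odd_gt0 oddN.
have [-> | a_gt0] := posnP a.
  by exists 1; rewrite addn0 coprime1n.
set c := N`_(\pi(a))^'.
have pc p : prime p -> p %| c -> p %| a -> False.
  move=> p_pr pc pa.
  have := pnatPpi (part_pnat (\pi(a)^')%N N) (_ : p \in \pi(c)).
  rewrite -/c mem_primes p_pr pc part_gt0 => /(_ isT).
  by rewrite /= inE /= mem_primes p_pr pa a_gt0.
have pN p : prime p -> p %| N -> (p %| a) || (p %| c).
  move=> p_pr; rewrite -{1}(partnC \pi(a) N_gt0) Euclid_dvdM // -/c.
  case/orP => [pNa | ->]; last by rewrite orbT.
  have := pnatPpi (part_pnat \pi(a) N) (_ : p \in \pi(N`_\pi(a))).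
  rewrite mem_primes p_pr pNa part_gt0 => /(_ isT).
  by rewrite mem_primes => /and3P[_ _ ->].
exists (a + c); split; apply: coprime_by_primes => // p p_pr.
  move=> pv /(pN p p_pr)/orP[pa | pc'].
    by apply: (pc p) => //; rewrite -(dvdn_addr c pa).
  by apply: (pc p) => //; rewrite -(dvdn_addl a pc').
have -> : a + c + a = 2 * a + c by lia.
move=> pv p_dvN; case/orP: (pN p p_pr p_dvN) => [pa | pc'].
  by apply: (pc p) => //; rewrite -(dvdn_addr c (dvdn_mull 2 pa)).
move: pv; rewrite (dvdn_addl _ pc') Euclid_dvdM // => /orP[p2 | ]; last exact: pc.
have := dvdn_odd p_dvN oddN.
by move: p2; rewrite dvdn_prime2 // => /eqP ->.
Qed.

(** Bezout: [km * m] exceeds [kn * d] by the gcd, so adding a suitable multiple of [km * m] to [a]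
    reaches [b] modulo [d]. *)
Lemma crt_pair (m d a b : nat) :
  (0 < m)%N -> a = b %[mod gcdn m d] ->
  exists x, x = a %[mod m] /\ x = b %[mod d].
Proof.
move=> m_gt0; have [-> | d_gt0] := posnP d.
  by rewrite gcdn0 => ab; exists b.
move=> ab.
have [km kn kE _] := egcdnP d m_gt0.
(* Adding [a * d] to [b] keeps the truncated subtraction exact. *)
have gab : gcdn m d %| (b + a * d) - a.
  rewrite -eqn_mod_dvd ?(leq_trans (leq_pmulr a d_gt0)) ?leq_addl //.
  rewrite -modnDmr (_ : (a * d) %% gcdn m d = 0) ?addn0 ?ab //.
  by apply/eqP; rewrite -/(dvdn _ _) dvdn_mull // dvdn_gcdr.
have [q qE] := dvdnP gab.
exists (a + km * m * q); split.
  by rewrite mulnAC addnC modnMDl.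
rewrite kE mulnDl addnA (_ : a + _ + _ = kn * q * d + (a + q * gcdn m d)); last by lia.
rewrite modnMDl -qE subnKC; first by rewrite addnC modnMDl.
exact: leq_trans (leq_pmulr a d_gt0) (leq_addl _ _).
Qed.

(** Gcd distributes over lcm; this gives the compatibility needed in the induction of [crt_seq]. *)
Lemma eqn_mod_gcd_lcm (s : seq nat) (d x y : nat) :
  (forall e, e \in s -> x = y %[mod gcdn e d]) ->
  x = y %[mod gcdn (foldr lcmn 1 s) d].
Proof.
elim: s => [|f s IHs] /= in x y * => H; first by rewrite gcd1n !modn1.
rewrite Order.NatDvd.meetUl.
wlog yx : x y H / y <= x.
  move=> W; case: (leqP y x) => [|/ltnW] yx; first exact: W.
  by symmetry; apply: W => // e /H.
apply/eqP; rewrite eqn_mod_dvd // dvdn_lcm -!eqn_mod_dvd // H ?inE ?eqxx //=.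
by apply/eqP/IHs => e es; apply: H; rewrite inE es orbT.
Qed.

Lemma crt_seq (t : nat -> nat) (s : seq nat) :
  (forall d, d \in s -> 0 < d)%N ->
  (forall d e, d \in s -> e \in s -> t d = t e %[mod gcdn d e]) ->
  exists x, forall d, d \in s -> x = t d %[mod d].
Proof.
move=> s_gt0 s_compat; pose L := foldr lcmn 1%N.
elim: s s_gt0 s_compat => [|d s IHs] s_gt0 s_compat; first by exists 0.
have [||x xP] := IHs.
- by move=> e es; apply: s_gt0; rewrite inE es orbT.
- by move=> e f es fs; apply: s_compat; rewrite inE ?es ?fs orbT.
have dvL r e : e \in r -> e %| L r.
  elim: r => //= f r IHr; rewrite inE => /predU1P[-> | /IHr]; first exact: dvdn_lcml.
  by move/dvdn_trans; apply; exact: dvdn_lcmr.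
have L_gt0 : 0 < L s.
  elim: s s_gt0 {IHs s_compat xP dvL} => //= f r IHr r_gt0.
  rewrite lcmn_gt0 r_gt0 ?inE ?eqxx ?orbT //= IHr // => e er.
  by apply: r_gt0; move: er; rewrite !inE => /predU1P[-> | ->]; rewrite ?eqxx ?orbT.
have xtd : x = t d %[mod gcdn (L s) d].
  apply: eqn_mod_gcd_lcm => e es; rewrite -(s_compat e d) ?inE ?es ?eqxx ?orbT //.
  by rewrite -(modn_dvdm x (dvdn_gcdl e d)) xP // modn_dvdm // dvdn_gcdl.
have [y [yx yd]] := crt_pair L_gt0 xtd.
exists y => e; rewrite inE => /predU1P[-> // | es].
by rewrite -(xP e es) -(modn_dvdm y (dvL _ _ es)) yx modn_dvdm ?dvL.
Qed.

(** Counts prime factors with multiplicity when [0 < x <= N]; the common bound [N] makes additivity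
    termwise. *)
Definition bigomega (N x : nat) : nat := \sum_(p < N.+1) logn p x.

Lemma bigomegaM (N x y : nat) : (0 < x)%N -> (0 < y)%N ->
  bigomega N (x * y) = (bigomega N x + bigomega N y)%N.
Proof.
move=> x_gt0 y_gt0; rewrite /bigomega -big_split /=.
by apply: eq_bigr => p _; rewrite lognM.
Qed.

Lemma bigomega_prime (N p : nat) : prime p -> (p <= N)%N -> bigomega N p = 1.
Proof.
move=> p_pr pN; rewrite /bigomega (bigD1 (Ordinal (pN : p < N.+1))) //=.
rewrite logn_prime // eqxx big1 // => q; rewrite -val_eqE /= => qp.
by rewrite logn_prime // (negPf qp).
Qed.

Lemma bigomega_gt0 (N x : nat) : (1 < x <= N)%N -> (0 < bigomega N x)%N.
Proof.
move=> /andP[x_gt1 xN]; have x_gt0 := ltnW x_gt1.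
have q_gt0 : 0 < x %/ pdiv x by rewrite divn_gt0 ?pdiv_gt0 ?pdiv_leq.
rewrite -(divnK (pdiv_dvd x)) bigomegaM ?pdiv_gt0 //.
rewrite (bigomega_prime (pdiv_prime x_gt1)) ?addn1 //.
exact: leq_trans (pdiv_leq x_gt0) xN.
Qed.

Lemma bigomega1_prime (N x : nat) :
  (1 < x <= N)%N -> (bigomega N x <= 1)%N -> prime x.
Proof.
move=> /andP[x_gt1 xN]; have x_gt0 := ltnW x_gt1.
have q_gt0 : 0 < x %/ pdiv x by rewrite divn_gt0 ?pdiv_gt0 ?pdiv_leq.
have p_pr := pdiv_prime x_gt1.
rewrite -{1}(divnK (pdiv_dvd x)) bigomegaM ?pdiv_gt0 //.
rewrite (bigomega_prime p_pr) ?(leq_trans (pdiv_leq x_gt0)) // => le1.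
case: (leqP (x %/ pdiv x) 1) => [q_le1 | q_gt1].
  have q1 : x %/ pdiv x = 1 by apply/eqP; rewrite eqn_leq q_le1.
  by rewrite -(divnK (pdiv_dvd x)) q1 mul1n.
have := @bigomega_gt0 N (x %/ pdiv x); rewrite q_gt1 /=.
rewrite (leq_trans (leq_div _ _) xN) => /(_ isT); lia.
Qed.

Lemma bigomega_prod_primes (N : nat) (s : seq nat) :
  (forall p, p \in s -> prime p) -> (\prod_(p <- s) p <= N)%N ->
  bigomega N (\prod_(p <- s) p) = size s.
Proof.
elim: s => [|p s IHs] s_pr; first by rewrite big_nil /bigomega big1 // => i; rewrite logn1.
have p_pr : prime p by apply: s_pr; rewrite inE eqxx.
have s_pr' q : q \in s -> prime q by move=> qs; apply: s_pr; rewrite inE qs orbT.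
have prod_gt0 : 0 < \prod_(q <- s) q.
  by rewrite big_seq; apply: prodn_cond_gt0 => q /s_pr'/prime_gt0.
rewrite big_cons => leN; rewrite bigomegaM ?(prime_gt0 p_pr) // bigomega_prime //; last first.
  by rewrite (leq_trans _ leN) ?leq_pmulr.
by rewrite IHs // (leq_trans _ leN) ?leq_pmull ?(prime_gt0 p_pr).
Qed.

(** At most three prime factors are available and [x], [y], [z] use at least one each, so none is
    left for [c]. *)
Lemma prime_factors_of_3_primes (s : seq nat) (x y z c : nat) :
  (size s <= 3)%N -> (forall p, p \in s -> prime p) ->
  (1 < x -> 1 < y -> 1 < z -> \prod_(p <- s) p = x * y * z * c ->
  [/\ prime x, prime y, prime z & c = 1])%N.
Proof.
move=> s_le3 s_pr x_gt1 y_gt1 z_gt1 E.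
set N := \prod_(p <- s) p.
have N_gt0 : 0 < N by rewrite /N big_seq prodn_cond_gt0 // => p /s_pr/prime_gt0.
have [x_gt0 y_gt0 z_gt0] := And3 (ltnW x_gt1) (ltnW y_gt1) (ltnW z_gt1).
have c_gt0 : 0 < c by move: N_gt0; rewrite /N E !muln_gt0 => /andP[].
have leN w : w %| N -> w <= N by exact: dvdn_leq.
have xN : x <= N by apply: leN; rewrite /N E -!mulnA dvdn_mulr.
have yN : y <= N by apply: leN; rewrite /N E -!mulnA mulnCA dvdn_mulr.
have zN : z <= N by apply: leN; rewrite /N E -mulnA mulnCA dvdn_mulr.
have cN : c <= N by apply: leN; rewrite /N E dvdn_mull.
have := bigomega_prod_primes s_pr (leqnn N).
rewrite -/N {2}/N E !bigomegaM ?muln_gt0 ?x_gt0 ?y_gt0 ?z_gt0 // => Os.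
have Ox := bigomega_gt0 (introT andP (conj x_gt1 xN)).
have Oy := bigomega_gt0 (introT andP (conj y_gt1 yN)).
have Oz := bigomega_gt0 (introT andP (conj z_gt1 zN)).
have le1_prime w : 1 < w -> w <= N -> bigomega N w <= 1 -> prime w.
  by move=> w_gt1 wN; apply: bigomega1_prime; rewrite w_gt1.
split; [apply: le1_prime => //; lia .. |].
apply/eqP; rewrite eqn_leq c_gt0 andbT leqNgt; apply/negP => c_gt1.
have := @bigomega_gt0 N c; rewrite c_gt1 cN => /(_ isT); lia.
Qed.

(** Divisors of a prime power form a chain. Otherwise, with [g] the gcd, the lcm [g * a * b] divides
    [n], and outside the first three cases its three factors exceed 1. *)
Lemma dvdn_dichotomy (n d e : nat) :
  (exists p k : nat, prime p /\ n = p ^ k) \/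
  (exists s : seq nat, [/\ size s <= 3,
     forall p : nat, p \in s -> prime p & n = \prod_(p <- s) p]) ->
  d %| n -> e %| n ->
  [\/ d %| e, e %| d, coprime d e |
     exists g a b, [/\ prime g, prime a, prime b & a != b] /\
       [/\ d = g * a, e = g * b & n = g * a * b]].
Proof.
move=> n_fact dn en.
have [de | /negP nde] := boolP (d %| e); first exact: Or41.
have [ed | /negP ned] := boolP (e %| d); first exact: Or42.
have [cde | /negP ncde] := boolP (coprime d e); first exact: Or43.
case: n_fact => [[p [k [p_pr nE]]] | [s [s_le3 s_pr nE]]].
  move: dn en; rewrite nE => /(dvdn_pfactor _ _ p_pr)[i _ dE].
  move/(dvdn_pfactor _ _ p_pr)=> [j _ eE]; move: nde ned; rewrite dE eE.
  by case: (leqP i j) => [|/ltnW] /(dvdn_exp2l p) H; [case|move=> _; case].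
have n_gt0 : 0 < n by rewrite nE big_seq prodn_cond_gt0 // => p /s_pr/prime_gt0.
have d_gt0 := dvdn_gt0 n_gt0 dn; have e_gt0 := dvdn_gt0 n_gt0 en.
set g := gcdn d e; have g_gt0 : 0 < g by rewrite gcdn_gt0 d_gt0.
have [a dE] := dvdnP (dvdn_gcdl d e); have [b eE] := dvdnP (dvdn_gcdr d e).
rewrite -/g in dE eE.
have ab : coprime a b.
  have := erefl g; rewrite {1}/g {1}dE {1}eE -muln_gcdl -{2}(mul1n g) => /eqP.
  by rewrite eqn_pmul2r.
have a_gt1 : 1 < a.
  rewrite ltn_neqAle eq_sym; apply/andP; split; last by move: d_gt0; rewrite dE muln_gt0 => /andP[].
  by apply/eqP => a1; apply: nde; rewrite dE a1 mul1n /g dvdn_gcdr.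
have b_gt1 : 1 < b.
  rewrite ltn_neqAle eq_sym; apply/andP; split; last by move: e_gt0; rewrite eE muln_gt0 => /andP[].
  by apply/eqP => b1; apply: ned; rewrite eE b1 mul1n /g dvdn_gcdl.
have g_gt1 : 1 < g.
  rewrite ltn_neqAle eq_sym g_gt0 andbT; apply/eqP => g1; apply: ncde.
  by rewrite /coprime -/g g1.
have : g * a * b %| n.
  have : lcmn d e %| n by rewrite dvdn_lcm dn.
  by rewrite dE eE -muln_lcml -(muln1 (lcmn a b)) -(eqP ab) muln_lcm_gcd mulnC mulnA.
case/dvdnP => c nE'; rewrite mulnC in nE'.
have [] := prime_factors_of_3_primes s_le3 s_pr g_gt1 a_gt1 b_gt1 (etrans (esym nE) nE').
move=> g_pr a_pr b_pr c1; apply: Or44; exists g, a, b; split; split=> //.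
- by apply: contraTneq ab => ->; rewrite /coprime gcdnn neq_ltn b_gt1 orbT.
- by rewrite mulnC.
- by rewrite mulnC.
- by rewrite nE' c1 muln1.
Qed.

Lemma eqn_mod_cancel (c d x y : nat) :
  coprime d c -> (c * x = c * y %[mod d] -> x = y %[mod d])%N.
Proof.
move=> dc; wlog xy : x y / (x <= y)%N.
  move=> W; case: (leqP x y) => [|/ltnW] xy cxy; first exact: W.
  by apply/esym/W.
move=> /esym/eqP; rewrite eqn_mod_dvd ?leq_mul // -mulnBr Gauss_dvdr // => dxy.
by apply/esym/eqP; rewrite eqn_mod_dvd.
Qed.

(** Here [d] is the order of [k] modulo [n]: the divisors of [n] represent the classes of
    frequencies of equal order. *)
Lemma gcdn_cofactor (k n : nat) : (0 < n)%N -> exists u d : nat,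
  [/\ k = (gcdn k n * u)%N, (gcdn k n * d)%N = n & coprime u d].
Proof.
move=> n_gt0; have [c cE] : exists c, gcdn k n = c by exists (gcdn k n).
have c_gt0 : (0 < c)%N by rewrite -cE gcdn_gt0 n_gt0 orbT.
have [u kE] : exists u, k = (u * c)%N by apply/dvdnP; rewrite -cE dvdn_gcdl.
have [d nE] : exists d, n = (d * c)%N by apply/dvdnP; rewrite -cE dvdn_gcdr.
exists u, d; rewrite cE; split; [by rewrite mulnC | by rewrite mulnC |].
move/eqP: cE; rewrite kE nE -muln_gcdl -[X in _ == X]mul1n.
by rewrite eqn_pmul2r.
Qed.

Import Order.TTheory GRing.Theory Num.Theory.
Local Open Scope ring_scope.

(** * Fourier transform *)

(** Frequencies are natural numbers, so divisibility arguments apply directly; -k is written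
    [m * k]. Values lie in [algC], where Galois automorphisms act. *)
Definition dft (m : nat) (w : algC) (h : 'I_m.+1 -> algC) (k : nat) : algC :=
  \sum_x h x * w ^+ (k * x).

Section Dft.

Variables (m : nat) (w : algC).
Hypothesis w_prim : m.+1.-primitive_root w.

Local Notation dft := (dft w).

Lemma prim_expD (k : nat) (x y : 'I_m.+1) :
  w ^+ (k * (x + y)%R) = w ^+ (k * x) * w ^+ (k * y).
Proof.
rewrite -exprD -mulnDr; apply/eqP.
by rewrite (eq_prim_root_expr w_prim) /= modnMmr.
Qed.

Lemma prim_exp_eq1 (k : nat) : (w ^+ k == 1) = (m.+1 %| k)%N.
Proof. by rewrite -(prim_order_dvd w_prim). Qed.

Lemma prim_expN (k x : nat) : w ^+ (m * k * x) * w ^+ (k * x) = 1.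
Proof.
by apply/eqP; rewrite -exprD prim_exp_eq1 -mulnA -mulSnr dvdn_mulr.
Qed.

Lemma prim_exp_neq0 (k : nat) : w ^+ k != 0.
Proof. by rewrite expf_neq0 // (prim_root_eq0 w_prim). Qed.

Lemma dft_mod (h : 'I_m.+1 -> algC) (k l : nat) :
  k = l %[mod m.+1] -> dft h k = dft h l.
Proof.
move=> kl; apply: eq_bigr => x _; congr (_ * _); apply/eqP.
by rewrite (eq_prim_root_expr w_prim) -modnMml kl modnMml.
Qed.

Lemma eq_dft (h h' : 'I_m.+1 -> algC) (k : nat) :
  h =1 h' -> dft h k = dft h' k.
Proof. by move=> hh'; apply: eq_bigr => x _; rewrite hh'. Qed.

Lemma dftD (h h' : 'I_m.+1 -> algC) (k : nat) :
  dft (fun x => h x + h' x) k = dft h k + dft h' k.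
Proof. by rewrite -big_split; apply: eq_bigr => x _; rewrite mulrDl. Qed.

Lemma dftN (h : 'I_m.+1 -> algC) (k : nat) :
  dft (fun x => - h x) k = - dft h k.
Proof. by rewrite -sumrN; apply: eq_bigr => x _; rewrite mulNr. Qed.

Lemma dft_sum (I : finType) (h : I -> 'I_m.+1 -> algC) (k : nat) :
  dft (fun x => \sum_i h i x) k = \sum_i dft (h i) k.
Proof.
by rewrite exchange_big; apply: eq_bigr => x _; rewrite mulr_suml.
Qed.

Lemma dft_shift (h : 'I_m.+1 -> algC) (s : 'I_m.+1) (k : nat) :
  dft (fun x => h (x + s)) k = dft h k * w ^+ (m * k * s).
Proof.
rewrite /dft [in RHS](reindex_inj (addIr s)) /= mulr_suml.
apply: eq_bigr => x _; rewrite prim_expD -!mulrA; congr (_ * _).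
by rewrite [X in _ * X]mulrC prim_expN mulr1.
Qed.

Lemma prim_exp_sum (x : 'I_m.+1) :
  \sum_(k < m.+1) w ^+ (k * x) = (x == 0)%:R * m.+1%:R.
Proof.
have [-> | x_neq0] := eqVneq x 0.
  rewrite mul1r (eq_bigr (fun=> 1)) ?sumr_const ?card_ord // => k _.
  by rewrite muln0.
rewrite mul0r; apply/eqP.
have := subrX1 (w ^+ x) m.+1.
rewrite -exprM mulnC exprM (prim_expr_order w_prim) expr1n subrr => /esym/eqP.
rewrite mulf_eq0 subr_eq0 prim_exp_eq1 => /orP[/dvdn_leq|].
  by rewrite lt0n => /(_ x_neq0); rewrite leqNgt ltn_ord.
by under eq_bigr do rewrite -exprM mulnC.
Qed.

Lemma dft_eq0 (h : 'I_m.+1 -> algC) :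
  (forall k, dft h k = 0) -> forall x, h x = 0.
Proof.
move=> h0 y.
have: \sum_(k < m.+1) dft (fun x => h (x + y)) k = h y * m.+1%:R.
  rewrite /dft exchange_big /= (bigD1 0) //.
  rewrite -mulr_sumr prim_exp_sum eqxx mul1r add0r big1 /= ?addr0 // => x x_neq0.
  by rewrite -mulr_sumr prim_exp_sum (negPf x_neq0) mul0r mulr0.
rewrite big1 => [/esym/eqP|k _]; last by rewrite dft_shift h0 mul0r.
by rewrite mulf_eq0 pnatr_eq0 orbF => /eqP.
Qed.

Lemma dft_inj (h h' : 'I_m.+1 -> algC) :
  (forall k, dft h k = dft h' k) -> h =1 h'.
Proof.
move=> hh' x; apply/eqP; rewrite -subr_eq0; apply/eqP.
by apply: (@dft_eq0 (fun x => h x - h' x)) => k; rewrite dftD dftN hh' subrr.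
Qed.

(** For fixed [x], the sums over [x1] and [x2] are transforms of the translate of [h] by [x]; their
    phases combine to the frequency -(k+l) in the sum over [x]. *)
Lemma dft_deck3 (h : 'I_m.+1 -> algC) (k l : nat) :
  \sum_x1 \sum_x2 deck3 h x1 x2 * (w ^+ (k * x1) * w ^+ (l * x2)) =
  dft h k * dft h l * dft h (m * (k + l)).
Proof.
transitivity (\sum_x h x * (dft (fun y => h (y + x)) k * dft (fun y => h (y + x)) l)).
  transitivity (\sum_x1 \sum_x2 \sum_x h x *
      ((h (x1 + x) * w ^+ (k * x1)) * (h (x2 + x) * w ^+ (l * x2)))).
    apply: eq_bigr => x1 _; apply: eq_bigr => x2 _.
    rewrite mulr_suml; apply: eq_bigr => x _.
    by rewrite !(addrC x) -!mulrA; congr (_ * (_ * _)); rewrite mulrCA.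
  under eq_bigr do rewrite exchange_big /=.
  rewrite exchange_big /=; apply: eq_bigr => x _.
  rewrite mulr_suml mulr_sumr; apply: eq_bigr => x1 _.
  by rewrite !mulr_sumr.
rewrite [RHS]mulr_sumr; apply: eq_bigr => x _.
by rewrite !dft_shift mulnDr mulnDl exprD; ring.
Qed.

Local Notation spec E := (dft (indicator algC E)).

(** The automorphism fixes the 0/1 values of an indicator, so it only multiplies frequencies by [u].
    A large [N] lets it act as a power on the ratio of spectra too. *)
Lemma dft_galois (g u N : nat) : coprime u N -> (m.+1 %| g * N)%N ->
  exists sigma : {rmorphism algC -> algC},
    (forall z, z ^+ N = 1 -> sigma z = z ^+ u) /\
    (forall (E : {set 'I_m.+1}) v, sigma (spec E (g * v)) = spec E (g * v * u)).
Proof.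
move=> uN gN; have [sigma sP] := Qn_aut_exists uN; exists sigma; split=> // E v.
rewrite rmorph_sum; apply: eq_bigr => x _; rewrite rmorphM /= /indicator rmorph_nat.
congr (_ * _); rewrite sP -?exprM ?[(g * v * u * x)%N]mulnAC //.
apply/eqP; rewrite prim_exp_eq1 (dvdn_trans gN) //.
by rewrite -!mulnA dvdn_mul // mulnA dvdn_mull.
Qed.

Lemma spec_galois_eq0 (E : {set 'I_m.+1}) (g u d : nat) :
  (g * d)%N = m.+1 -> coprime u d -> (spec E (g * u) == 0) = (spec E g == 0).
Proof.
move=> gd ud; have [|sigma [_ /(_ E 1%N)]] := dft_galois (g := g) ud; first by rewrite gd.
by rewrite !muln1 => <-; rewrite fmorph_eq0.
Qed.

Lemma spec_neg_eq0 (E : {set 'I_m.+1}) (k : nat) :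
  (spec E (m * k) == 0) = (spec E k == 0).
Proof.
have [||sigma [_ /(_ E k)]] := @dft_galois 1 m m.+1.
- by rewrite coprimenS.
- by rewrite mul1n.
by rewrite mul1n mulnC => <-; rewrite fmorph_eq0.
Qed.

Lemma spec0 (E : {set 'I_m.+1}) : spec E 0 = #|E|%:R.
Proof.
rewrite -sum1_card natr_sum [RHS]big_mkcond; apply: eq_bigr => x _.
by rewrite mul0n mulr1 /indicator; case: (x \in E).
Qed.

End Dft.

(** * The ratio of the spectra *)

Section EqualDecks.

Variables (m : nat) (w : algC).
Hypothesis w_prim : m.+1.-primitive_root w.
Hypothesis n_odd : odd m.+1.
Variables E F : {set 'I_m.+1}.

Local Notation X := (dft w (indicator algC E)).
Local Notation Y := (dft w (indicator algC F)).

Hypothesis XY_triple : forall k l, X k * X l * X (m * (k + l)) = Y k * Y l * Y (m * (k + l)).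
Hypothesis X0_neq0 : X 0 != 0.

Lemma eq_spec0 : Y 0 = X 0.
Proof.
have := XY_triple 0 0; rewrite addn0 muln0 -!expr2 -!exprSr !spec0 => /esym/eqP.
by rewrite eqrXn2 ?ler0n // => /eqP.
Qed.

Lemma XY_norm k : X k * X (m * k) = Y k * Y (m * k).
Proof.
have := XY_triple k 0; rewrite addn0 eq_spec0 -!mulrA ![X 0 * _]mulrC !mulrA.
exact: mulIf.
Qed.

(** Supports are symmetric under negation, so if only one value vanished, exactly one side of
    [XY_norm] would be 0. *)
Lemma spec_eq0 k : (Y k == 0) = (X k == 0).
Proof.
have := XY_norm k; have := spec_neg_eq0 w_prim E k; have := spec_neg_eq0 w_prim F k.
case: (eqVneq (X k) 0) (eqVneq (Y k) 0) => [->|Xk] [->|Yk] //= YN XN /eqP.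
  by rewrite mul0r eq_sym mulf_eq0 (negPf Yk) YN.
by rewrite mul0r mulf_eq0 (negPf Xk) XN.
Qed.

Local Notation r k := (Y k / X k).

(** The triple relation says r(k) r(l) r(-k-l) = 1, and [XY_norm] says that r(-k-l) inverts
    r(k+l). *)
Lemma ratioD k l : X k != 0 -> X l != 0 -> X (k + l) != 0 ->
  r (k + l) = r k * r l.
Proof.
move=> Xk Xl Xkl; have XN := spec_neg_eq0 w_prim E (k + l).
have := XY_triple k l; have := XY_norm (k + l).
have Xm : X (m * (k + l)) != 0 by rewrite XN.
have Ym : Y (m * (k + l)) != 0 by rewrite spec_eq0 XN.
move=> En Et; apply: (mulIf Ym); apply: (mulIf Xkl).
transitivity (X (k + l) * X (m * (k + l))); first by rewrite En; field.
transitivity ((Y k * Y l * Y (m * (k + l))) * X (k + l) / (X k * X l)).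
  by rewrite -Et; field; rewrite Xl. 
by field; rewrite Xl.
Qed.

(* The doubling rule makes the ratio a root of unity of odd order, and a Galois
   automorphism raising roots of unity to the power [u] maps the ratio at [g]
   to the ratio at [g u]. Taking [u = v] and [u = v + d], which give the same
   frequency, forces the order to divide [d]. *)
Lemma ratio_order (g d : nat) : (g * d)%N = m.+1 -> X g != 0 ->
  r g ^+ d = 1.
Proof.
move=> gd Xg; have d_odd : odd d by move: n_odd; rewrite -gd oddM => /andP[].
have g_odd : odd g by move: n_odd; rewrite -gd oddM => /andP[].
have Yg : Y g != 0 by rewrite spec_eq0.
have rg_neq0 : r g != 0 by rewrite mulf_neq0 ?invr_eq0.
have co2 j : coprime (2 ^ j) d by rewrite coprimeXl // coprime2n.
have X2 j : X (g * 2 ^ j) != 0 by rewrite (spec_galois_eq0 w_prim _ gd).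
have r2 j : r (g * 2 ^ j) = r g ^+ (2 ^ j).
  elim: j => [|j IHj]; first by rewrite muln1 expr1.
  have gD : (g * 2 ^ j.+1 = g * 2 ^ j + g * 2 ^ j)%N by rewrite expnS; lia.
  by rewrite gD ratioD -?gD // IHj -exprD addnn -mul2n -expnS.
(* By Euler, [g * 2 ^ j] is the frequency [g] again, so r(g) has order dividing 2^j - 1. The factor
   [d] makes [dft_galois] applicable at [g]. *)
set j := totient d; set N := (d * (2 ^ j - 1))%N.
have d_gt0 : (0 < d)%N by exact: odd_gt0.
have j_gt0 : (0 < j)%N by rewrite totient_gt0.
have rN : r g ^+ N = 1.
  suff r1 : r g ^+ (2 ^ j - 1) = 1 by rewrite /N mulnC exprM r1 expr1n.
  apply: (mulIf rg_neq0); rewrite -exprSr -addn1 subnK ?expn_gt0 // mul1r -r2.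
  suff jg : (g * 2 ^ j = g * 1 %[mod m.+1])%N by rewrite !(dft_mod w_prim _ jg) muln1.
  by rewrite -gd -!muln_modr (Euler_exp_totient (co2 1)).
have N_odd : odd N.
  by rewrite /N oddM d_odd oddB ?expn_gt0 // oddX eqn0Ngt j_gt0.
have [v [vN vdN]] := coprime_pair_diff d N_odd.
have rv u : coprime u N -> r (g * u) = r g ^+ u.
  move=> uN; have [|sigma [sz sX]] := dft_galois w_prim (g := g) uN.
    by rewrite -gd dvdn_mul // dvdn_mulr.
  by rewrite -(sz _ rN) fmorph_div -[g in RHS]muln1 !sX muln1.
have gv : (g * v = g * (v + d) %[mod m.+1])%N by rewrite mulnDr gd modnDr.
have := rv _ vdN; rewrite -!(dft_mod w_prim _ gv) rv // exprD => /esym/eqP.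
by rewrite -subr_eq0 -{2}(mulr1 (r g ^+ v)) -mulrBr mulf_eq0 expf_eq0 (negPf rg_neq0)
  andbF subr_eq0 => /eqP.
Qed.

(** A d-th root of unity is a power of w^g, which gives [t] at [g]; Galois conjugation carries the
    formula to [g * u]. *)
Lemma ratio_character (g d : nat) : (g * d)%N = m.+1 -> X g != 0 ->
  exists t, forall u, coprime u d -> Y (g * u) = w ^+ (g * u * t) * X (g * u).
Proof.
move=> gd Xg; have rd := ratio_order gd Xg.
have g_gt0 : (0 < g)%N by case: g gd {Xg rd}.
have rn : r g ^+ m.+1 = 1 by rewrite -gd mulnC exprM rd expr1n.
have [i ri] := prim_rootP w_prim rn.
have: (m.+1 %| i * d)%N by rewrite -(prim_exp_eq1 w_prim) exprM -ri rd.
rewrite -[X in (X %| _)%N]gd dvdn_pmul2r; last by case: d gd {rd}; rewrite ?muln0.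
case/dvdnP => t it; exists t => u ud.
have [|sigma [sz sX]] := dft_galois w_prim (g := g) ud; first by rewrite gd.
have := sz _ rd; rewrite fmorph_div -{1 2}(muln1 g) !sX muln1 ri -exprM it.
rewrite -[(t * g * u)%N]mulnA [(t * _)%N]mulnC => <-.
by rewrite divfK // (spec_galois_eq0 w_prim _ gd).
Qed.

Lemma ratio_exp (g d t : nat) : (g * d)%N = m.+1 -> X g != 0 ->
  (forall u, coprime u d -> Y (g * u) = w ^+ (g * u * t) * X (g * u)) ->
  forall u, coprime u d -> r (g * u) = w ^+ (g * u * t).
Proof.
by move=> gd Xg H u ud; rewrite H // mulfK // (spec_galois_eq0 w_prim _ gd).
Qed.

Lemma character_compat_dvd (g d g' d' t t' : nat) :
  (g * d)%N = m.+1 -> (g' * d')%N = m.+1 -> (d %| d')%N -> X g != 0 -> X g' != 0 ->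
  (forall u, coprime u d -> Y (g * u) = w ^+ (g * u * t) * X (g * u)) ->
  (forall u, coprime u d' -> Y (g' * u) = w ^+ (g' * u * t') * X (g' * u)) ->
  t = t' %[mod d].
Proof.
move=> gd gd' /dvdnP[a d'E] Xg Xg' H H'.
have d_gt0 : (0 < d)%N by case: d gd {H d'E}; rewrite ?muln0.
have g_gt0 : (0 < g)%N by case: g gd {H Xg}.
have gE : g = (g' * a)%N.
  by apply/eqP; rewrite -(eqn_pmul2r d_gt0) gd -mulnA -d'E gd'.
have d'_odd : odd d' by move: n_odd; rewrite -gd' oddM => /andP[].
(* [g = g' * a] is the difference of [g' * (v + a)] and [g' * v], both of order [d']. *)
have [v [vd' vad']] := coprime_pair_diff a d'_odd.
have gva : (g' * (v + a) = g' * v + g)%N by rewrite mulnDr gE.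
have Xv u : coprime u d' -> X (g' * u) != 0 by move=> ud'; rewrite (spec_galois_eq0 w_prim _ gd').
have := ratioD (Xv _ vd') Xg; rewrite -gva => /(_ (Xv _ vad')).
rewrite !(ratio_exp gd' Xg' H') //.
have := ratio_exp gd Xg H (coprime1n d); rewrite muln1 => ->.
rewrite gva mulnDl exprD => /(mulfI (prim_exp_neq0 w_prim _))/eqP.
by rewrite (eq_prim_root_expr w_prim) -gd -!muln_modr eqn_pmul2l // => /eqP.
Qed.

Lemma character_compat_sum (g a b t t' t'' : nat) :
  (g * a * b)%N = m.+1 -> coprime g a -> coprime g b -> coprime a b ->
  X b != 0 -> X a != 0 -> X g != 0 ->
  (forall u, coprime u (g * a) -> Y (b * u) = w ^+ (b * u * t) * X (b * u)) ->
  (forall u, coprime u (g * b) -> Y (a * u) = w ^+ (a * u * t') * X (a * u)) ->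
  (forall u, coprime u (a * b) -> Y (g * u) = w ^+ (g * u * t'') * X (g * u)) ->
  t = t' %[mod g].
Proof.
move=> gab coga cogb coab Xb Xa Xg Hb Ha Hg.
have [g_gt0 a_gt0 b_gt0] : [/\ 0 < g, 0 < a & 0 < b]%N.
  by move: (ltn0Sn m); rewrite -gab !muln_gt0 -andbA => /and3P[].
have Eb : (b * (g * a))%N = m.+1 by rewrite mulnC.
have Ea : (a * (g * b))%N = m.+1 by rewrite -gab; lia.
have Eg : (g * (a * b))%N = m.+1 by rewrite mulnA.
(* [b * u + a * v = g * z] with [u, v, z] units to the orders of the three frequencies *)
pose u := (a * g.-1 + g)%N; pose v := (b + g)%N; pose z := (a * b + b + a)%N.
have uga : coprime u (g * a).
  rewrite coprimeMr; apply/andP; split.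
    by rewrite /u /coprime gcdnC gcdnDr -/(coprime _ _) coprimeMr coga coprimenP.
  by rewrite coprime_sym /coprime /u mulnC gcdnMDl -/(coprime _ _) coprime_sym.
have vgb : coprime v (g * b).
  by rewrite coprimeMr ![coprime v _]coprime_sym /coprime gcdnDr gcdnDl
    -!/(coprime _ _) cogb coprime_sym.
have zab : coprime z (a * b).
  rewrite coprimeMr ![coprime z _]coprime_sym /z; apply/andP; split.
    by rewrite /coprime gcdnDr [(a * b)%N]mulnC gcdnMDl.
  by rewrite -addnA addnCA /coprime gcdnDl gcdnMDl -/(coprime _ _) coprime_sym.
have uvz : (b * u + a * v = g * z)%N.
  by rewrite /u /v /z; case: (g) g_gt0 => //= k _; lia.
have XM k d x : (k * d)%N = m.+1 -> X k != 0 -> coprime x d -> X (k * x) != 0.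
  by move=> kd Xk xd; rewrite (spec_galois_eq0 w_prim _ kd).
have := ratioD (XM _ _ _ Eb Xb uga) (XM _ _ _ Ea Xa vgb).
rewrite uvz => /(_ (XM _ _ _ Eg Xg zab)).
rewrite (ratio_exp Eb Xb Hb) // (ratio_exp Ea Xa Ha) // (ratio_exp Eg Xg Hg) //.
rewrite -exprD => /eqP; rewrite (eq_prim_root_expr w_prim) => /eqP Emod.
have g_dvd : (g %| m.+1)%N by rewrite -Eg dvdn_mulr.
apply: (@eqn_mod_cancel (b * u)).
  rewrite coprimeMr cogb coprime_sym.
  by move: uga; rewrite coprimeMr => /andP[].
(* After adding [a * v * t'], both sides are congruent to multiples of [g]. *)
apply/eqP; rewrite -(eqn_modDr (a * v * t')) -mulnDl uvz.
rewrite -(modn_dvdm (b * u * t + _) g_dvd) -Emod modn_dvdm //.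
by rewrite -!mulnA !modnMr.
Qed.

End EqualDecks.

(** * Spectra supported on two quotients *)

Section Fibres.

Variables (m : nat) (w : algC).
Hypothesis w_prim : m.+1.-primitive_root w.
Variable E : {set 'I_m.+1}.

Local Notation X := (dft w (indicator algC E)).

Lemma prim_exp_inZp (k x : nat) : w ^+ (k * (inZp x : 'I_m.+1)) = w ^+ (k * x).
Proof. by apply/eqP; rewrite (eq_prim_root_expr w_prim) /= modnMmr. Qed.

(** The second difference of the indicator has transform X(k)(w^(-ks) - 1)(w^(-kt) - 1), where some
    factor is always 0. *)
Lemma mixed_difference_eq0 (s t : nat) :
  (forall k, X k != 0 -> (m.+1 %| k * s)%N || (m.+1 %| k * t)%N) ->
  forall x : 'I_m.+1, (((x + inZp s + inZp t)%R \in E) + (x \in E) =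
    ((x + inZp s)%R \in E) + ((x + inZp t)%R \in E))%N.
Proof.
move=> Xst x; apply/eqP; rewrite -(eqr_nat algC) !natrD; apply/eqP.
pose f := indicator algC E; pose sh u : 'I_m.+1 -> algC := fun y => f (y + u).
pose s' : 'I_m.+1 := inZp s; pose t' : 'I_m.+1 := inZp t.
apply: (dft_inj w_prim (h := fun y => sh t' (y + s') + f y)
  (h' := fun y => sh s' y + sh t' y)) => k.
rewrite !dftD (dft_shift w_prim (sh t') s') !(dft_shift w_prim f).
have [-> | /Xst kst] := eqVneq (X k) 0; first by rewrite !mul0r !addr0.
have shift1 (u : nat) : (m.+1 %| k * u)%N -> w ^+ (m * k * (inZp u : 'I_m.+1)) = 1.
  move=> ku; apply/eqP; rewrite prim_exp_inZp (prim_exp_eq1 w_prim).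
  by rewrite -mulnA dvdn_mull.
by case/orP: kst => /shift1 ->; rewrite ?mulr1 // addrC.
Qed.

Lemma shift_invariant_vanish (s k : nat) :
  (forall x : 'I_m.+1, (x + inZp s \in E) = (x \in E)) -> ~~ (m.+1 %| k * s)%N -> X k = 0.
Proof.
move=> Es ks; pose s' : 'I_m.+1 := inZp s.
have := dft_shift w_prim (indicator algC E) s' k.
rewrite (eq_dft w k (h' := indicator algC E)); last by move=> x; rewrite /indicator Es.
move/(congr1 (fun z => z * w ^+ (k * s'))); rewrite -[RHS]mulrA prim_expN // mulr1.
move/eqP; rewrite -subr_eq0 -{2}(mulr1 (X k)) -mulrBr mulf_eq0 subr_eq0.
by rewrite prim_exp_inZp (prim_exp_eq1 w_prim) (negPf ks) orbF => /eqP.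
Qed.

(** For n = g a b with [a], [b] coprime, [s = g * a] and [t = g * b], this counts the points of [E]
    on the fibre of [x] modulo [g]. *)
Definition fibre_count (s t a b : nat) (x : 'I_m.+1) : nat :=
  (\sum_(i < b) \sum_(j < a) ((x + inZp (s * i) + inZp (t * j))%R \in E))%N.

Lemma fibre_countC s t a b x : fibre_count s t a b x = fibre_count t s b a x.
Proof.
rewrite /fibre_count exchange_big; apply: eq_bigr => j _; apply: eq_bigr => i _.
by rewrite addrAC.
Qed.

Lemma geometric_sum_eq0 (k s b : nat) :
  (m.+1 %| k * s * b)%N -> ~~ (m.+1 %| k * s)%N ->
  \sum_(i < b) w ^+ (m * k * (inZp (s * i) : 'I_m.+1)) = 0.
Proof.
move=> ksb ks; set z := w ^+ (m * k * s).
have z1 : z != 1.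
  rewrite (prim_exp_eq1 w_prim) -mulnA Gauss_dvdr //.
  by rewrite coprimeSn.
transitivity (\sum_(i < b) z ^+ i).
  by apply: eq_bigr => i _; rewrite prim_exp_inZp mulnA exprM.
apply/eqP; have := subrX1 z b; rewrite -exprM.
have -> : w ^+ (m * k * s * b) = 1.
  by apply/eqP; rewrite (prim_exp_eq1 w_prim) -!mulnA dvdn_mull // mulnA.
by rewrite subrr => /esym/eqP; rewrite mulf_eq0 subr_eq0 (negPf z1).
Qed.

(** The transform of the count is [X k] times a geometric sum per direction. One factor vanishes
    unless n divides [k], so the count equals its translates. *)
Lemma fibre_count_const (s t a b : nat) :
  (m.+1 %| s * b)%N -> (m.+1 %| t * a)%N ->
  (forall k, X k != 0 -> (m.+1 %| k * s)%N -> (m.+1 %| k * t)%N -> (m.+1 %| k)%N) ->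
  forall x y, fibre_count s t a b x = fibre_count s t a b y.
Proof.
move=> sb ta Xst x y.
pose f := indicator algC E.
pose M (z : 'I_m.+1) : algC := (fibre_count s t a b z)%:R.
have dftM k : dft w M k = X k * (\sum_(i < b) w ^+ (m * k * (inZp (s * i) : 'I_m.+1)))
    * (\sum_(j < a) w ^+ (m * k * (inZp (t * j) : 'I_m.+1))).
  rewrite (eq_dft w k (h' := fun z => \sum_(i < b) \sum_(j < a)
     f (z + inZp (s * i) + inZp (t * j)))); last first.
    by move=> z; rewrite /M /fibre_count natr_sum; apply: eq_bigr => i _; rewrite natr_sum.
  move: (erefl (X k)); move: {-2}(X k) => c fE.
  rewrite dft_sum -mulrA mulr_suml mulr_sumr; apply: eq_bigr => i _.
  rewrite dft_sum !mulr_sumr; apply: eq_bigr => j _.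
  rewrite (dft_shift w_prim (fun z => f (z + inZp (t * j))) (inZp (s * i))).
  by rewrite (dft_shift w_prim f) fE -mulrA [X in _ * X]mulrC.
apply/eqP; rewrite -(eqr_nat algC); apply/eqP.
rewrite -/(M x) -/(M y) -(subrK y x) addrC; set u := x - y.
apply: (dft_inj w_prim (h := fun z => M (z + u))) => k.
rewrite dft_shift //; have [kn | nkn] := boolP (m.+1 %| k)%N.
  suff -> : w ^+ (m * k * u) = 1 by rewrite mulr1.
  by apply/eqP; rewrite (prim_exp_eq1 w_prim) dvdn_mulr // dvdn_mull.
suff -> : dft w M k = 0 by rewrite mul0r.
rewrite dftM; have [-> | Xk] := eqVneq (X k) 0; first by rewrite !mul0r.
have [ks | nks] := boolP (m.+1 %| k * s)%N; last first.
  by rewrite geometric_sum_eq0 ?mulr0 ?mul0r // -mulnA dvdn_mull.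
rewrite (@geometric_sum_eq0 k t a) ?mulr0 //; first by rewrite -mulnA dvdn_mull.
by apply: contra nkn; exact: Xst.
Qed.

(* If [E] is not invariant under the shift by [t] somewhere on a fibre, it is
   invariant under the shift by [s] on all of it, since the indicator takes
   only the values 0 and 1. *)
Lemma fibre_count_dichotomy (s t a b : nat) (x : 'I_m.+1) :
  (forall k, X k != 0 -> (m.+1 %| k * s)%N || (m.+1 %| k * t)%N) ->
  (1 < a)%N -> (x + inZp t \in E) != (x \in E) ->
  exists2 q, fibre_count s t a b x = (b * q)%N & (0 < q < a)%N.
Proof.
move=> Xst a_gt1 xt; pose e (y : 'I_m.+1) : nat := y \in E.
have mixed i j : (e (x + inZp (s * i) + inZp (t * j))%R + e x =
    e (x + inZp (s * i))%R + e (x + inZp (t * j))%R)%N.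
  apply: mixed_difference_eq0 => k /Xst /orP[] h; apply/orP; [left|right];
    by rewrite mulnA dvdn_mulr.
(* Take [j = 1]: as [e] differs at [x] and [x + inZp t], 0/1 values leave no other solution. *)
have xs i : e (x + inZp (s * i)) = e x.
  have := mixed i 1%N; rewrite muln1 /e; move: xt.
  by do 4!case: (_ \in E).
pose q := (\sum_(j < a) e (x + inZp (t * j))%R)%N.
exists q.
  rewrite /fibre_count (eq_bigr (fun=> q)) ?sum_nat_const ?card_ord // => i _.
  apply: eq_bigr => j _; rewrite -/(e _).
  by have := mixed i j; rewrite xs addnC => /addnI.
have a_gt0 := ltnW a_gt1.
(* The terms [j = 0] and [j = 1] of [q] contribute exactly 1, which keeps [q] away from 0 and
   [a]. *)
have q2 : (0 < e x + e (x + inZp t)%R < 2)%N.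
  by move: xt; rewrite /e; do 2!case: (_ \in E).
have qE : q = (e x + e (x + inZp t)%R + \sum_(j < a.-2) e (x + inZp (t * j.+2))%R)%N.
  rewrite /q; case: (a) a_gt1 => [|[|c]] // _; rewrite !big_ord_recl addnA /=.
  have -> : inZp (t * 0) = 0 :> 'I_m.+1 by rewrite muln0; apply: val_inj; rewrite /= mod0n.
  by rewrite addr0 /bump /= muln1.
have rest : (\sum_(j < a.-2) e (x + inZp (t * j.+2))%R <= a.-2)%N.
  rewrite -[leqRHS]card_ord -sum1_card; apply: leq_sum => j _.
  by rewrite /e; case: (_ \in E).
rewrite qE; lia.
Qed.

Lemma spec_support_two_quotients (g a b : nat) :
  (g * a * b)%N = m.+1 -> coprime a b -> (1 < a)%N -> (1 < b)%N ->
  (forall k, X k != 0 -> (a %| k)%N || (b %| k)%N) ->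
  (forall k, X k != 0 -> (a * b %| k)%N -> (m.+1 %| k)%N) ->
  X a != 0 -> X b != 0 -> False.
Proof.
move=> gab coab a_gt1 b_gt1 Xab Xn Xa Xb.
have [g_gt0 a_gt0 b_gt0] : [/\ 0 < g, 0 < a & 0 < b]%N.
  by move: (ltn0Sn m); rewrite -gab !muln_gt0 -andbA => /and3P[].
have dvds k : (m.+1 %| k * (g * a))%N = (b %| k)%N.
  by rewrite -gab mulnC dvdn_pmul2r ?muln_gt0 ?g_gt0.
have dvdt k : (m.+1 %| k * (g * b))%N = (a %| k)%N.
  by rewrite -gab mulnAC mulnC dvdn_pmul2r ?muln_gt0 ?g_gt0.
have ndvd c d : coprime c d -> (1 < c)%N -> ~~ (c %| d)%N.
  by move=> cd c_gt1; apply: contraL cd => cd; rewrite /coprime (gcdn_idPl cd) neq_ltn c_gt1 orbT.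
(* Invariance under [g * b] would force [X b = 0], since [a] does not divide [b]. *)
have [x xt] : exists x : 'I_m.+1, (x + inZp (g * b) \in E) != (x \in E).
  apply/existsP/contraT; rewrite negb_exists => /forallP inv.
  have := @shift_invariant_vanish (g * b) b; rewrite dvdt ndvd // => H.
  by move: Xb; rewrite H ?eqxx // => z; apply/eqP; move: (inv z); rewrite negbK.
have [y ys] : exists y : 'I_m.+1, (y + inZp (g * a) \in E) != (y \in E).
  apply/existsP/contraT; rewrite negb_exists => /forallP inv.
  have := @shift_invariant_vanish (g * a) a; rewrite dvds ndvd 1?coprime_sym // => H.
  by move: Xa; rewrite H ?eqxx // => z; apply/eqP; move: (inv z); rewrite negbK.
have [|q qE /andP[q_gt0 q_lt]] := fibre_count_dichotomy b _ a_gt1 xt (s := (g * a)%N).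
  by move=> k /Xab; rewrite dvds dvdt orbC.
have [|q' q'E _] := fibre_count_dichotomy a _ b_gt1 ys (s := (g * b)%N).
  by move=> k /Xab; rewrite dvds dvdt.
(* Equal counts give [b * q = a * q'], so [a] divides [q], against [0 < q < a]. *)
have := fibre_count_const (s := (g * a)%N) (t := (g * b)%N) (a := a) (b := b) _ _ _ x y.
rewrite qE fibre_countC q'E.
rewrite gab dvdnn mulnAC gab dvdnn => /(_ isT isT) Q.
have : (a %| b * q)%N.
  rewrite Q ?dvdn_mulr // => k Xk; rewrite dvds dvdt => bk ak.
  by apply: Xn => //; rewrite Gauss_dvd // ak.
by rewrite Gauss_dvdr // => /(dvdn_leq q_gt0); rewrite leqNgt q_lt.
Qed.

End Fibres.

(** * Reconstruction *)

Lemma spec_gcd_eq0 (m : nat) (w : algC) (E : {set 'I_m.+1}) (k : nat) :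
  m.+1.-primitive_root w ->
  (dft w (indicator algC E) (gcdn k m.+1) == 0) = (dft w (indicator algC E) k == 0).
Proof.
move=> w_prim; have [u [d [kE nE ud]]] := gcdn_cofactor k (ltn0Sn m).
by rewrite {2}kE (spec_galois_eq0 w_prim _ nE).
Qed.

(** Natural-number decks carry equality from the reals to [algC]. *)
Lemma deck3_indicator_natr (R : pzSemiRingType) (G : finZmodType) (E : {set G}) (x1 x2 : G) :
  deck3 (indicator R E) x1 x2 = (deck3 (indicator nat E) x1 x2)%:R.
Proof.
rewrite /deck3 natr_sum; apply: eq_bigr => x _.
by rewrite /indicator !natrM !natn.
Qed.

Section Reconstruction.

Variables (m : nat) (w : algC) (E F : {set 'I_m.+1}).
Hypothesis w_prim : m.+1.-primitive_root w.
Hypothesis n_odd : odd m.+1.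
Hypothesis n_fact :
  (exists p k : nat, prime p /\ m.+1 = (p ^ k)%N) \/
  (exists s : seq nat, [/\ (size s <= 3)%N,
     forall p : nat, p \in s -> prime p & m.+1 = (\prod_(p <- s) p)%N]).

Local Notation X := (dft w (indicator algC E)).
Local Notation Y := (dft w (indicator algC F)).

Hypothesis XY_triple : forall k l,
  X k * X l * X (m * (k + l)) = Y k * Y l * Y (m * (k + l)).
Hypothesis X0_neq0 : X 0 != 0.

(** The frequencies 1, [a * b], [g] have orders n, [g], [a * b]. If all alternatives fail,
    [spec_support_two_quotients] is contradicted. *)
Lemma two_quotients_spec (g a b : nat) :
  prime g -> prime a -> prime b -> a != b -> (g * a * b)%N = m.+1 ->
  X a != 0 -> X b != 0 ->
  [\/ X 1 != 0, X (a * b) != 0 | [/\ X g != 0, coprime g a & coprime g b]].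
Proof.
move=> g_pr a_pr b_pr ab gab Xa Xb.
have [X1 | X1] := eqVneq (X 1) 0; last exact: Or31.
have [Xab | Xab] := eqVneq (X (a * b)) 0; last exact: Or32.
have [gP | /negP ngP] := boolP [&& X g != 0, coprime g a & coprime g b].
  by apply: Or33; apply/and3P.
have coab : coprime a b by rewrite prime_coprime // dvdn_prime2.
have [_ g_div] := primeP g_pr.
have [] := spec_support_two_quotients w_prim gab coab (prime_gt1 a_pr) (prime_gt1 b_pr) _ _ Xa Xb.
  move=> k; rewrite -(spec_gcd_eq0 _ _ w_prim) => Xc.
  apply: contraT; rewrite negb_or -!prime_coprime // => /andP[ak bk].
  have: (gcdn k m.+1 %| g)%N.
    have := dvdn_gcdr k m.+1; rewrite -{2}gab Gauss_dvdl; last first.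
      by rewrite coprime_sym (coprime_dvdr (dvdn_gcdl _ _)).
    by rewrite Gauss_dvdl // coprime_sym (coprime_dvdr (dvdn_gcdl _ _)).
  move=> /g_div /pred2P[] cE; first by move: Xc; rewrite cE X1 eqxx.
  case: ngP; rewrite -cE Xc /= ![coprime (gcdn _ _) _]coprime_sym.
  by rewrite !(coprime_dvdr (dvdn_gcdl _ _)).
move=> k; rewrite -(spec_gcd_eq0 _ _ w_prim) => Xc abk.
have abc : (a * b %| gcdn k m.+1)%N by rewrite dvdn_gcd abk -gab -mulnA dvdn_mull.
have [c cE] := dvdnP abc.
have ab_gt0 : (0 < a * b)%N by rewrite muln_gt0 !prime_gt0.
have : (c %| g)%N.
  by rewrite -(dvdn_pmul2r ab_gt0) -cE mulnA gab dvdn_gcdr.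
move=> /g_div /pred2P[] c1.
  by move: Xc; rewrite cE c1 mul1n Xab eqxx.
by rewrite -gab -mulnA -c1 -cE dvdn_gcdl.
Qed.

Lemma character_compat (g d g' d' t t' : nat) :
  (g * d)%N = m.+1 -> (g' * d')%N = m.+1 -> X g != 0 -> X g' != 0 ->
  (forall u, coprime u d -> Y (g * u) = w ^+ (g * u * t) * X (g * u)) ->
  (forall u, coprime u d' -> Y (g' * u) = w ^+ (g' * u * t') * X (g' * u)) ->
  t = t' %[mod gcdn d d'].
Proof.
move=> gd gd' Xg Xg' H H'.
have dn : (d %| m.+1)%N by rewrite -gd dvdn_mull.
have dn' : (d' %| m.+1)%N by rewrite -gd' dvdn_mull.
have compat := character_compat_dvd w_prim n_odd XY_triple X0_neq0.
case: (dvdn_dichotomy n_fact dn dn').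
- by move=> dd'; rewrite (gcdn_idPl dd'); exact: compat H H'.
- by move=> dd'; rewrite (gcdn_idPr dd'); apply: esym; exact: compat H' H.
- by move/eqP => ->; rewrite !modn1.
case=> h [a [b [[h_pr a_pr b_pr ab] [dE d'E /esym hab]]]].
have [h_gt0 a_gt0 b_gt0] := And3 (prime_gt0 h_pr) (prime_gt0 a_pr) (prime_gt0 b_pr).
have gE : g = b.
  by apply/eqP; rewrite -(eqn_pmul2r (_ : 0 < d)%N) ?gd ?dE ?muln_gt0 ?h_gt0 // -hab mulnC.
have g'E : g' = a.
  apply/eqP; rewrite -(eqn_pmul2r (_ : 0 < d')%N) ?gd' ?d'E ?muln_gt0 ?h_gt0 // -hab.
  by rewrite mulnCA mulnA.
subst d d' g g'.
have coab : coprime a b by rewrite prime_coprime // dvdn_prime2.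
have -> : gcdn (h * a) (h * b) = h by rewrite -muln_gcdr (eqP coab) muln1.
have [X1 | Xab | [Xh coha cohb]] := two_quotients_spec h_pr a_pr b_pr ab hab Xg' Xg.
(* The order n is a multiple of both orders, so [t] and [t'] both agree with [s]. *)
- have [s Hs] := ratio_character w_prim n_odd XY_triple X0_neq0 (mul1n m.+1) X1.
  have Hd := compat _ _ _ _ _ _ gd (mul1n _) dn Xg X1 H Hs.
  have Hd' := compat _ _ _ _ _ _ gd' (mul1n _) dn' Xg' X1 H' Hs.
  rewrite -(modn_dvdm t (dvdn_mulr a (dvdnn h))) Hd modn_dvdm ?dvdn_mulr //.
  by rewrite -(modn_dvdm t' (dvdn_mulr b (dvdnn h))) Hd' modn_dvdm ?dvdn_mulr.
(* The order [h] divides both orders. *)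
- have abh : (a * b * h)%N = m.+1 by rewrite -hab mulnC mulnA.
  have [s Hs] := ratio_character w_prim n_odd XY_triple X0_neq0 abh Xab.
  rewrite -(compat _ _ _ _ _ _ abh gd (dvdn_mulr _ (dvdnn h)) Xab Xg Hs H).
  exact: (compat _ _ _ _ _ _ abh gd' (dvdn_mulr _ (dvdnn h)) Xab Xg' Hs H').
have [s Hs] := ratio_character w_prim n_odd XY_triple X0_neq0 (etrans (mulnA _ _ _) hab) Xh.
exact: (character_compat_sum w_prim n_odd XY_triple X0_neq0 hab coha cohb coab Xg Xg' Xh H H' Hs).
Qed.

Lemma spec_ratio_global : exists t, forall k, Y k = w ^+ (k * t) * X k.
Proof.
pose P d t := (d %| m.+1)%N -> X (m.+1 %/ d) != 0 ->
  forall u, coprime u d ->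
  Y (m.+1 %/ d * u) = w ^+ (m.+1 %/ d * u * t) * X (m.+1 %/ d * u).
have /choice[T TP] : forall d, exists t, P d t.
  (* Where [P d] is vacuous, 0 is a placeholder; [D] keeps only orders in the support. *)
  move=> d; have [dn | ndn] := boolP (d %| m.+1)%N; last by exists 0%N => dn; rewrite dn in ndn.
  have [Xd | Xd] := eqVneq (X (m.+1 %/ d)) 0; first by exists 0%N => _; rewrite Xd eqxx.
  have [t tP] := ratio_character w_prim n_odd XY_triple X0_neq0 (divnK dn) Xd.
  by exists t => _ _.
pose D := [seq d <- divisors m.+1 | X (m.+1 %/ d) != 0].
have DP d : d \in D -> (d %| m.+1)%N /\ X (m.+1 %/ d) != 0.
  by rewrite mem_filter -dvdn_divisors // => /andP[].
have [||t tP] := @crt_seq T D.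
- by move=> d /DP[dn _]; exact: dvdn_gt0 dn.
- move=> d e /DP[dn Xd] /DP[en Xe].
  by apply: (character_compat (divnK dn) (divnK en) Xd Xe); exact: TP.
exists t => k.
have [Xk | Xk] := eqVneq (X k) 0.
  rewrite Xk mulr0; apply/eqP.
  by rewrite (spec_eq0 w_prim XY_triple X0_neq0) Xk.
have [u [d [kE nE ud]]] := gcdn_cofactor k (ltn0Sn m).
set c := gcdn k m.+1 in kE nE.
have d_gt0 : (0 < d)%N by case: d nE {ud}; rewrite ?muln0.
have cE : (m.+1 %/ d)%N = c by rewrite -nE mulnK.
have dn : (d %| m.+1)%N by rewrite -nE dvdn_mull.
have Xc : X (m.+1 %/ d) != 0 by rewrite cE (spec_gcd_eq0 _ _ w_prim).
have := TP d dn Xc u ud; rewrite cE -kE => ->; congr (_ * _).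
(* As [k = c * u] and n = [c * d], the exponent modulo n depends only on [t] modulo [d]. *)
apply/eqP; rewrite (eq_prim_root_expr w_prim) kE -!mulnA -nE -!muln_modr.
rewrite eqn_pmul2l ?gcdn_gt0 ?orbT // -modnMmr -(tP d) ?modnMmr //.
by rewrite mem_filter Xc -dvdn_divisors.
Qed.

End Reconstruction.

Theorem theorem1 (R : realType) (m : nat)
    (hn : (exists p k : nat, [/\ prime p, odd p & m.+1 = (p ^ k)%N]) \/
          (exists s : seq nat,
             [/\ (size s <= 3)%N,
                 forall p : nat, p \in s -> prime p /\ odd p
               & m.+1 = (\prod_(p <- s) p)%N]))
    (E F : {set 'I_m.+1})
    (hdeck : forall x1 x2 : 'I_m.+1,
       deck3 (indicator R E) x1 x2 = deck3 (indicator R F) x1 x2) :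
  exists t : 'I_m.+1, F = translate E t.
Proof.
have n_odd : odd m.+1.
  case: hn => [[p [k [_ p_odd ->]]] | [s [_ s_odd ->]]]; first by rewrite oddX p_odd orbT.
  rewrite big_seq; elim/big_rec: _ => // p x /s_odd[_ p_odd] x_odd.
  by rewrite oddM p_odd.
have n_fact : (exists p k : nat, prime p /\ m.+1 = (p ^ k)%N) \/
  (exists s : seq nat, [/\ (size s <= 3)%N,
     forall p : nat, p \in s -> prime p & m.+1 = (\prod_(p <- s) p)%N]).
  case: hn => [[p [k [p_pr _ nE]]] | [s [s_le s_pr nE]]]; first by left; exists p, k.
  by right; exists s; split=> // p /s_pr[].
have [w w_prim] := C_prim_root_exists (ltn0Sn m).
pose X := dft w (indicator algC E); pose Y := dft w (indicator algC F).
have deck_algC x1 x2 :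
    deck3 (indicator algC E) x1 x2 = deck3 (indicator algC F) x1 x2.
  rewrite !(deck3_indicator_natr algC); apply/eqP.
  rewrite eqr_nat -(eqr_nat R) -!deck3_indicator_natr.
  exact/eqP/hdeck.
have XY k l : X k * X l * X (m * (k + l))%N = Y k * Y l * Y (m * (k + l))%N.
  rewrite -!(dft_deck3 w_prim); apply: eq_bigr => x1 _; apply: eq_bigr => x2 _.
  by rewrite deck_algC.
(* [X 0] is the cardinal of [E]; if it is 0, the relation at 0 makes [F] empty too. *)
have [X0 | X0] := eqVneq (X 0%N) 0.
  have := XY 0%N 0%N; rewrite X0 !mul0r => /esym/eqP.
  rewrite addn0 muln0 !mulf_eq0 !orbb; move/eqP: X0.
  rewrite /X /Y !spec0 !pnatr_eq0 !cards_eq0 => /eqP -> /eqP ->.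
  by exists 0; rewrite /translate imset0.
have [t tP] := spec_ratio_global w_prim n_odd n_fact XY X0.
pose s : 'I_m.+1 := inZp t; exists s.
have shift (x : 'I_m.+1) : (x + s \in F) = (x \in E).
  have: indicator algC F (x + s) = indicator algC E x.
    (* The phase of the shift by [s] cancels [w ^+ (k * t)]. *)
    apply: (dft_inj w_prim (h := fun y => indicator algC F (y + s))) => k.
    rewrite dft_shift // tP mulrAC prim_exp_inZp // -[RHS]mul1r; congr (_ * _).
    by rewrite mulrC prim_expN.
  by move/eqP; rewrite /indicator eqr_nat; do 2!case: (_ \in _).
apply/setP => y; rewrite -(subrK s y) shift.
by rewrite (mem_imset _ _ (addIr s)).
Qed.
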